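(* Let $n,k\ge 1$ and let $V_1,\dots,V_k:\mathbb{R}^n\to\mathbb{R}^n$ be smooth vector fields with induced flows $F_1,\dots,F_k:\mathbb{R}^n\times\mathbb{R}\to\mathbb{R}^n$. Let $x_0\in\mathbb{R}^n$ be a regular K-stasis point with weighting $(m_1,\dots,m_k)$; that is, $m_j>0$ for all $j$, $\sum_{j=1}^k m_j=1$, $\sum_{j=1}^k m_jV_j(x_0)=0$, and the $n\times n$ matrix $\sum_{j=1}^k m_j\frac{\partial V_j}{\partial x}(x_0)$ is non-singular. Then for all sufficiently small $\delta>0$ there exists a K-cycle with time vector $(\delta m_1,\dots,\delta m_k)$; that is, there exists $\delta_0>0$ such that for every $\delta\in(0,\delta_0)$ there are points $x_1,\dots,x_k\in\mathbb{R}^n$ with $F_j(x_j,\delta m_j)=x_{j+1}$ for $j=1,\dots,k-1$ and $F_k(x_k,\delta m_k)=x_1$.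
   Context: The flow $F_j:\mathbb{R}^n\times\mathbb{R}\to\mathbb{R}^n$ induced by $V_j$ is the map with $F_j(x,0)=x$ and $\frac{\partial}{\partial t}F_j(x,t)=V_j(F_j(x,t))$; it is assumed to be defined for all $(x,t)\in\mathbb{R}^n\times\mathbb{R}$. $\frac{\partial V_j}{\partial x}(x_0)$ denotes the Jacobian matrix of $V_j$ at $x_0$. A point $x_0\in\mathbb{R}^n$ is a K-stasis point if $\sum_{j=1}^k m_jV_j(x_0)=0$ for some probability weighting $(m_1,\dots,m_k)$, where each $m_j>0$ and $\sum_j m_j=1$. The stasis point is regular if $\sum_{j=1}^k m_j\frac{\partial V_j}{\partial x}(x_0)$ is non-singular. A K-cycle is a sequence of points $x_1,\dots,x_k$ in $\mathbb{R}^n$ together with a sequence of times (the time vector) $(\delta_1,\dots,\delta_k)$, each $\delta_j>0$, such that $F_1(x_1,\delta_1)=x_2$, $F_2(x_2,\delta_2)=x_3$, $\dots$, $F_k(x_k,\delta_k)=x_1$. *)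

(* Defs.v *)
From HB Require Import structures.
From mathcomp Require Import all_boot all_order all_algebra.
From mathcomp Require Import all_classical all_reals all_analysis.

Set Implicit Arguments.
Unset Strict Implicit.
Unset Printing Implicit Defensive.

Import Order.TTheory GRing.Theory Num.Theory.
Import numFieldNormedType.Exports.

Local Open Scope classical_set_scope.
Local Open Scope ring_scope.

(* Class C^r: the Fréchet derivative exists everywhere and is of class
   C^(r-1); in finite dimension the latter is equivalent to all the maps
   x |-> 'd f x v = 'D_v f x being of class C^(r-1). *)
Fixpoint class_C (R : realType) (n p r : nat) (f : 'rV[R]_n -> 'rV[R]_p) : Prop :=
  match r with
  | 0%N => continuous f
  | r'.+1 => (forall x, differentiable f x) /\ (forall v, class_C r' ('D_v f))
  end.

Definition smooth (R : realType) (n p : nat) (f : 'rV[R]_n -> 'rV[R]_p) : Prop :=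
  forall r, class_C r f.

Definition is_flow (R : realType) (n : nat) (V : 'rV[R]_n -> 'rV[R]_n)
    (F : 'rV[R]_n -> R -> 'rV[R]_n) : Prop :=
  (forall x, F x 0 = x) /\
  (forall x (t : R), is_derive t (1 : R) (F x) (V (F x t))).

Definition prob_weighting (R : realType) (k : nat) (m : 'I_k -> R) : Prop :=
  (forall j, 0 < m j) /\ \sum_(j < k) m j = 1.

Definition stasis_point (R : realType) (n k : nat)
    (V : 'I_k -> 'rV[R]_n -> 'rV[R]_n) (m : 'I_k -> R) (x0 : 'rV[R]_n) : Prop :=
  prob_weighting m /\ \sum_(j < k) m j *: V j x0 = 0.

(* The library's ['J f x] acts on row vectors from the right, so its (i, l)
   entry is the derivative of the l-th component in the i-th variable; the
   transpose gives the usual Jacobian matrix. *)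
Definition regular_stasis_point (R : realType) (n k : nat)
    (V : 'I_k -> 'rV[R]_n -> 'rV[R]_n) (m : 'I_k -> R) (x0 : 'rV[R]_n) : Prop :=
  stasis_point V m x0 /\
  (\sum_(j < k) m j *: (jacobian (V j) x0)^T : 'M[R]_n) \in unitmx.

(* [ordS] is the cyclic successor on 'I_k, so the last point is mapped back
   to the first one. *)
Definition cycle_with_times (R : realType) (n k : nat)
    (F : 'I_k -> 'rV[R]_n -> R -> 'rV[R]_n)
    (x : 'I_k -> 'rV[R]_n) (delta : 'I_k -> R) : Prop :=
  (forall j, 0 < delta j) /\
  (forall j, F j (x j) (delta j) = x (ordS j)).

(* Main.v *)
(** Write [g_d] for the composition of the flows at times [d * m_j]. Near the
    stasis point, uniformly as [d -> 0+],
      [g_d x0 = x0 + o(d)] and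
      [g_d x - g_d y = (x - y) + d (x - y) A + o(d) |x - y|]
    with [A] the weighted sum of the Jacobians. Such first order expansions hold
    for each flow and compose by adding up the vectors and matrices involved.
    Hence [x |-> x - d^-1 (g_d x - x) A^-1] is a contraction of a small closed
    ball around [x0]; its fixed point is a fixed point of [g_d], and the points
    visited along the composition form the cycle. *)
Require Import Defs.
From HB Require Import structures.
From mathcomp Require Import all_boot all_order all_algebra.
From mathcomp Require Import all_classical all_reals all_analysis.
From mathcomp Require Import ring lra.
Import Order.TTheory GRing.Theory Num.Theory.
Import numFieldNormedType.Exports.
Local Open Scope classical_set_scope.
Local Open Scope ring_scope.

Set Implicit Arguments.
Unset Strict Implicit.
Unset Printing Implicit Defensive.

(** Joins completeness with the normed structure of real matrices, so that [banach_fixed_point]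
    applies to row vectors. *)
HB.instance Definition _ (R : realType) (m n : nat) :=
  Complete.copy 'M[R]_(m, n) 'M[R]_(m, n).

(** * Mean value inequalities for curves *)

Section mean_value.
Context {R : realType} {n : nat}.

Lemma coord_le_norm (x : 'rV[R]_n) j : `|x 0 j| <= `|x|.
Proof.
rewrite [leRHS]/Num.Def.normr/= mx_normrE.
exact: (le_bigmax _ (fun ij => `|x ij.1 ij.2|) (0, j)).
Qed.

Lemma norm_le_coord (x : 'rV[R]_n) M :
  0 <= M -> (forall j, `|x 0 j| <= M) -> `|x| <= M.
Proof.
move=> M0 xM; rewrite [leLHS]/Num.Def.normr/= mx_normrE.
by rewrite bigmax_le// => -[i j] _ /=; rewrite ord1.
Qed.

(** The norm is the maximum of the coordinates, so the scalar mean value theorem is applied to each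
    coordinate, with its own intermediate time. *)
Lemma mean_value_le (f f' : R -> 'rV[R]_n) M (t : R) : 0 <= t ->
  (forall s : R, is_derive s (1 : R) f (f' s)) ->
  (forall s, 0 <= s -> s < t -> `|f' s| <= M) ->
  `|f t - f 0| <= M * t.
Proof.
move=> t0 fd fM; have [->|tn0] := eqVneq t 0.
  by rewrite subrr normr0 mulr0.
have {}t0 : 0 < t by rewrite lt_neqAle eq_sym tn0.
have M0 : 0 <= M by apply: le_trans (fM 0 _ _).
apply: norm_le_coord => [|j]; first by rewrite mulr_ge0// ltW.
have fjd s : is_derive s (1 : R) (fun u => f u 0 j) (f' s 0 j).
  have [fs <-] := fd s; rewrite derive_mx// mxE.
  by apply: derivableP; have /derivable_mxP := fs; apply.
have cont : {within `[0, t], continuous (fun u => f u 0 j)}.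
  apply: continuous_subspaceT => s.
  by apply/differentiable_continuous/derivable1_diffP; have [] := fjd s.
have [c] := MVT t0 (fun s _ => fjd s) cont.
rewrite in_itv/= => /andP[c0 ct] e.
rewrite !mxE e subr0 normrM (gtr0_norm t0) ler_pM2r//.
by apply: le_trans (fM c _ _) => //; [exact: coord_le_norm | exact: ltW].
Qed.

(* At the first exit time the mean value inequality still applies, so the ball
   has not been left. *)
Lemma mean_value_confined (f f' : R -> 'rV[R]_n) (c : 'rV[R]_n) (rho M T : R) :
  (forall s : R, is_derive s (1 : R) f (f' s)) ->
  (forall s, 0 <= s -> s <= T -> `|f s - c| < rho -> `|f' s| <= M) ->
  `|f 0 - c| + M * T < rho -> 0 <= M ->
  forall t, 0 <= t -> t <= T -> `|f t - c| < rho /\ `|f t - f 0| <= M * t.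
Proof.
move=> fd fM rhoT M0.
suff conf : forall t, 0 <= t -> t <= T -> `|f t - c| < rho.
  move=> t t0 tT; split; first exact: conf.
  apply: (@mean_value_le f f') => // s s0 st.
  have sT : s <= T by apply: le_trans tT; exact: ltW.
  by apply: fM => //; exact: conf.
move=> t t0 tT; rewrite ltNge; apply/negP => rft.
pose S := [set u | 0 <= u] `&` [set u | rho <= `|f u - c|].
have fc : continuous f.
  move=> s; apply/differentiable_continuous/derivable1_diffP.
  by have [] := fd s.
have clS : closed S.
  apply: closedI; first exact: closed_ge.
  apply: (@preimage_closed _ _ (fun u => `|f u - c|) [set x | rho <= x]).
    by move=> u _; apply: cvg_norm; apply: cvgB; [exact: fc|exact: cvg_cst].
  exact: closed_ge.
have lbS : has_lbound S by exists 0 => u [].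
have St : S t by [].
have Si : has_inf S by split => //; exists t.
(* Closedness of [S] makes its infimum an actual exit time; before it [fM] applies. *)
have [i0 ri] : S (inf S).
  apply: clS => B /nbhs_ballP[e /= e0 eB].
  have [u Su ue] := inf_adherent e0 Si; exists u; split => //; apply: eB.
  by rewrite -ball_normE/= distrC ger0_norm ?subr_ge0 ?ge_inf// ltrBlDl.
have iT : inf S <= T by apply: le_trans tT; exact: ge_inf.
have fMi : `|f (inf S) - f 0| <= M * inf S.
  apply: (@mean_value_le f f') => // s s0 si.
  apply: fM => //; first exact: (le_trans (ltW si)).
  rewrite ltNge; apply/negP => rs; move: si; rewrite ltNge => /negP; apply.
  exact: ge_inf.
move: ri => /=; rewrite leNgt => /negP; apply.
apply: le_lt_trans rhoT; rewrite -(subrKA (f 0)) (le_trans (ler_normD _ _))//.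
by rewrite addrC lerD2l (le_trans fMi)// ler_wpM2l.
Qed.

End mean_value.

(** * Strict differentiability of C^1 fields *)

Section strict_differentiability.
Context {R : realType} {n : nat}.

Definition row_sum_norm (A : 'M[R]_n) : R := \sum_i `|row i A|.

Lemma row_sum_norm_ge0 A : 0 <= row_sum_norm A.
Proof. exact: sumr_ge0. Qed.

Lemma norm_mulmx_le (x : 'rV[R]_n) A : `|x *m A| <= row_sum_norm A * `|x|.
Proof.
rewrite mulmx_sum_row (le_trans (ler_norm_sum _ _ _))// /row_sum_norm mulr_suml.
apply: ler_sum => i _; rewrite normrZ mulrC ler_wpM2l//.
exact: coord_le_norm.
Qed.

Definition strictly_differentiable_at (V : 'rV[R]_n -> 'rV[R]_n) x0 A :=
  forall e, 0 < e -> \forall r \near 0^'+, forall x y : 'rV[R]_n,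
    `|x - x0| < r -> `|y - x0| < r ->
    `|V x - V y - (x - y) *m A| <= e * `|x - y|.

(** The difference quotient along the line is, term by term, that of the directional derivative at
    [y + s *: w]. *)
Lemma is_derive_line (V : 'rV[R]_n -> 'rV[R]_n) y w (s : R) :
  differentiable V (y + s *: w) ->
  is_derive s (1 : R) (fun u => V (y + u *: w)) ('D_w V (y + s *: w)).
Proof.
move=> Vd; have := @diff_derivable _ _ _ V (y + s *: w) w Vd.
have E : (fun h : R => h^-1 *: (V (h *: w + (y + s *: w)) - V (y + s *: w))) =
  (fun h : R => h^-1 *: (V (y + (h *: 1 + s) *: w) - V (y + s *: w))).
  apply/funext => h; congr (_ *: (V _ - _)).
  by rewrite [h *: 1]mulr1 scalerDl addrCA.
rewrite /derivable E => Vder.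
by split => //; rewrite /derive E.
Qed.

Lemma is_derive_scaler (w : 'rV[R]_n) (s : R) :
  is_derive s (1 : R) (fun u => u *: w) w.
Proof.
have [_ idE] := is_derive_id (0 + s *: w) w.
rewrite -[X in is_derive _ _ _ X]idE.
have -> : (fun u : R => u *: w) = (fun u => id (0 + u *: w)).
  by apply/funext => u; rewrite add0r.
by apply: is_derive_line; exact: ex_diff.
Qed.

Lemma is_derive_lineB (V : 'rV[R]_n -> 'rV[R]_n) y w (J : 'M[R]_n) (s : R) :
  differentiable V (y + s *: w) ->
  is_derive s (1 : R) (fun u => V (y + u *: w) - u *: (w *m J))
    (w *m (jacobian V (y + s *: w) - J)).
Proof.
move=> Vd; rewrite mulmxBr; have <- := deriveEjacobian w Vd.
by apply: is_deriveB; [exact: is_derive_line | exact: is_derive_scaler].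
Qed.

(** Along the segment from [y] to [x], [V] minus its linear part at [x0] has derivative
    [(x - y) *m (J(z) - J(x0))], which is small by continuity of the partial derivatives; the mean
    value inequality on [[0, 1]] concludes. *)
Lemma class_C1_strictly_differentiable (V : 'rV[R]_n -> 'rV[R]_n) x0 :
  class_C 1 V -> strictly_differentiable_at V x0 (jacobian V x0).
Proof.
move=> [Vd DVc] e e0.
have rowJ z i : row i (jacobian V z) = 'D_(delta_mx 0 i) V z.
  by rewrite rowE deriveEjacobian.
have Jnear : \forall y \near x0,
    row_sum_norm (jacobian V y - jacobian V x0) <= e.
  (* The row sum has [n] terms; dividing by [n.+1] also covers [n = 0]. *)
  have e1 : 0 < e / n.+1%:R by rewrite divr_gt0.
  have : \forall y \near x0, forall i : 'I_n,
      `|'D_(delta_mx 0 i) V x0 - 'D_(delta_mx 0 i) V y| <= e / n.+1%:R.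
    apply: (@filter_forall _ _ (fun i y => `|'D_(delta_mx 0 i) V x0 -
      'D_(delta_mx 0 i) V y| <= e / n.+1%:R) (nbhs x0)) => i.
    have /cvgrPdist_le := DVc (delta_mx 0 i) x0; exact.
  apply: filterS => y Hy; apply: (@le_trans _ _ (\sum_(i < n) e / n.+1%:R)).
    apply: ler_sum => i _; apply: le_trans (Hy i).
    by rewrite distrC -!rowJ raddfB.
  rewrite sumr_const card_ord -[X in X <= _]mulr_natr -mulrA ger_pMr//.
  by rewrite ler_pdivrMl// mulr1 ler_nat.
have /nbhs_ballP[d /= d0 Hd] := Jnear.
near=> r => x y xr yr; set J := jacobian V x0 in Hd *.
have := @mean_value_le R n (fun s => V (y + s *: (x - y)) - s *: ((x - y) *m J))
  (fun s => (x - y) *m (jacobian V (y + s *: (x - y)) - J))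
  (e * `|x - y|) 1 ler01.
rewrite !scale1r !scale0r addr0 subr0 mulr1 (addrC y) subrK addrAC; apply.
  by move=> s; exact: is_derive_lineB.
move=> s s0 s1; apply: (le_trans (norm_mulmx_le _ _)); rewrite ler_wpM2r//.
apply: Hd; rewrite -ball_normE/= distrC.
(* A convex combination: the ball contains the segment. *)
have -> : y + s *: (x - y) - x0 = s *: (x - x0) + (1 - s) *: (y - x0).
  rewrite scalerBl scale1r !scalerBr opprB.
  by apply/rowP => i; rewrite !mxE; ring.
have : r < d by near: r; exact: nbhs_right_lt.
apply: le_lt_trans; rewrite (le_trans (ler_normD _ _))// !normrZ.
rewrite (ger0_norm s0) (@ger0_norm _ (1 - s)) ?subr_ge0 ?(ltW s1)//.
nra.
Unshelve. all: by end_near. Qed.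

End strict_differentiability.

(** * First order expansions and their composition *)

Section expansion.
Context {R : realType} {n : nat}.
Implicit Types (g h : R -> 'rV[R]_n -> 'rV[R]_n) (x y v w : 'rV[R]_n).
Implicit Types (A B : 'M[R]_n) (d e r rho K : R).

Lemma ler_norm3D x y v : `|x + y + v| <= `|x| + `|y| + `|v|.
Proof. by rewrite (le_trans (ler_normD _ _))// lerD2r ler_normD. Qed.

(** The one parameter [r] bounds both the time [d] and the distance to [x0], so that [expands] needs
    a single filter. *)
Definition expansion_error_le g x0 v A e r :=
  (forall d, 0 < d -> d <= r -> `|g d x0 - x0 - d *: v| <= e * d) /\
  (forall d x y, 0 < d -> d <= r -> `|x - x0| <= r -> `|y - x0| <= r ->
     `|g d x - g d y - (x - y) - d *: ((x - y) *m A)| <= e * d * `|x - y|).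

Definition expands g x0 v A :=
  forall e, 0 < e -> \forall r \near 0^'+, expansion_error_le g x0 v A e r.

(** The cruder O(d) form of the expansion, used to control the cross terms of a composition. *)
Definition displacement_le g x0 K r :=
  (forall d, 0 < d -> d <= r -> `|g d x0 - x0| <= K * d) /\
  (forall d x y, 0 < d -> d <= r -> `|x - x0| <= r -> `|y - x0| <= r ->
     `|g d x - g d y - (x - y)| <= K * d * `|x - y|).

Lemma expands_id x0 : expands (fun _ => id) x0 0 0.
Proof.
move=> e e0; near=> r; split=> [d d0 _|d x y d0 _ _ _].
  by rewrite subrr scaler0 subrr normr0 mulr_ge0// ltW.
rewrite subrr mulmx0 scaler0 subrr normr0.
by rewrite mulr_ge0// mulr_ge0// ltW.
Unshelve. all: by end_near. Qed.

Lemma expands_scale g x0 v A (c : R) : 0 < c -> expands g x0 v A ->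
  expands (fun d => g (d * c)) x0 (c *: v) (c *: A).
Proof.
move=> c0 gE e e0; have ec0 : 0 < e / c by rewrite divr_gt0.
near (0 : R)^'+ => rho.
have [g0 gL] : expansion_error_le g x0 v A (e / c) rho.
  by near: rho; exact: gE.
(* Precision [e / c] at time [d * c] is precision [e] at time [d]. *)
have eE d : e * d = e / c * (d * c) by field; rewrite gt_eqF.
near=> r.
have : r < rho / c by near: r; apply: nbhs_right_lt; rewrite divr_gt0.
rewrite ltr_pdivlMr// => rrho.
have rlt : r < rho by near: r; exact: nbhs_right_lt.
split=> [d d0 dr|d x y d0 dr xr yr].
  rewrite scalerA eE; apply: g0; first by rewrite mulr_gt0.
  by nra.
rewrite -scalemxAr scalerA eE; apply: gL; [by rewrite mulr_gt0|nra|lra|lra].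
Unshelve. all: by end_near. Qed.

Lemma expands_displacement g x0 v A : expands g x0 v A ->
  exists2 K, 0 < K & \forall r \near 0^'+, displacement_le g x0 K r.
Proof.
move=> gE; exists (row_sum_norm A + `|v| + 1).
  by rewrite ltr_wpDl// addr_ge0// row_sum_norm_ge0.
near=> r.
have [g0 gL] : expansion_error_le g x0 v A 1 r by near: r; exact: gE.
have A0 := row_sum_norm_ge0 A.
split=> [d d0 dr|d x y d0 dr xr yr].
  rewrite -(subrK (d *: v) (g d x0 - x0)).
  rewrite (le_trans (ler_normD _ _))// normrZ gtr0_norm//.
  by have := g0 d d0 dr; have := mulr_ge0 A0 (ltW d0); lra.
rewrite -(subrK (d *: ((x - y) *m A)) (g d x - _ - _)).
rewrite (le_trans (ler_normD _ _))// normrZ gtr0_norm//.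
have gxy := gL d x y d0 dr xr yr.
have : d * `|(x - y) *m A| <= d * (row_sum_norm A * `|x - y|).
  by rewrite ler_pM2l// norm_mulmx_le.
have : 0 <= `|v| * d * `|x - y| by rewrite !mulr_ge0// ltW.
lra.
Unshelve. all: by end_near. Qed.

Lemma displacement_stay g x0 K rho : 0 < rho -> 0 < K ->
  (\forall r \near 0^'+, displacement_le g x0 K r) ->
  \forall r \near 0^'+, forall d x, 0 < d -> d <= r -> `|x - x0| <= r ->
    `|g d x - x0| <= rho.
Proof.
move=> rho0 K0 gK; near=> r => d x d0 dr xr.
have [g0 gL] : displacement_le g x0 K r by near: r; exact: gK.
have r0 : 0 < r by exact: lt_le_trans dr.
have r1 : r <= 1 by near: r; exact: nbhs_right_le.
(* Going through [x0], the distance is at most [K * d * r + r + K * d], hence at most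
   [(2 * K + 1) * r] since [d <= r <= 1]. *)
have : r <= rho / (2 * K + 1).
  by near: r; apply: nbhs_right_le; rewrite divr_gt0// addr_gt0// mulr_gt0.
rewrite ler_pdivlMr; last by rewrite addr_gt0// mulr_gt0.
have -> : g d x - x0 =
    (g d x - g d x0 - (x - x0)) + (x - x0) + (g d x0 - x0).
  by rewrite subrK subrKA.
have := g0 d d0 dr; have := gL d x x0 d0 dr xr.
rewrite subrr normr0 => /(_ (ltW r0)) gx gx0 rr.
rewrite (le_trans (ler_norm3D _ _ _))//.
have : K * d * `|x - x0| <= K * r * 1.
  rewrite ler_pM// ?mulr_ge0 ?(ltW K0) ?(ltW d0)//; first by rewrite ler_pM2l.
  exact: le_trans r1.
have : K * d <= K * r by rewrite ler_pM2l.
lra.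
Unshelve. all: by end_near. Qed.

(** Besides the errors of [g] and [h], the only new terms come from applying [h] to points already
    displaced by [g]. They carry an extra factor [d], or [r] at the base point, and are absorbed by
    shrinking [r]. *)
Lemma expands_comp g h x0 v w A B : expands g x0 v A -> expands h x0 w B ->
  expands (fun d => h d \o g d) x0 (v + w) (A + B).
Proof.
move=> gE hE; have [Kg Kg0 gK] := expands_displacement gE.
have [Kh Kh0 hK] := expands_displacement hE.
move=> e e0; have e4 : 0 < e / 4 by rewrite divr_gt0.
have C0 := row_sum_norm_ge0 B.
(* [h] is controlled on the ball of radius [rho]; [r] is chosen afterwards so that [g d] maps the
   [r]-ball into it. *)
near (0 : R)^'+ => rho.
have [h0 hL] : expansion_error_le h x0 w B (e / 4) rho.
  by near: rho; exact: hE.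
have [_ hd] : displacement_le h x0 Kh rho by near: rho; exact: hK.
have rho0 : 0 < rho by [].
near=> r.
have [g0 gL] : expansion_error_le g x0 v A (e / 4) r by near: r; exact: gE.
have [gd0 gd] : displacement_le g x0 Kg r by near: r; exact: gK.
have stay : forall d x, 0 < d -> d <= r -> `|x - x0| <= r ->
    `|g d x - x0| <= rho by near: r; exact: displacement_stay gK.
have rrho : r <= rho by near: r; exact: nbhs_right_le.
have r0 : 0 <= r by rewrite ltW.
split=> [d d0 dr|d x y d0 dr xr yr] /=.
  (* Makes the cross term [Kh * d * (Kg * r)] at most [e / 4 * d]. *)
  have : r <= e / (4 * Kh * Kg).
    by near: r; apply: nbhs_right_le; rewrite divr_gt0// !mulr_gt0.
  rewrite ler_pdivlMr ?mulr_gt0// => rK.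
  have drho := le_trans dr rrho.
  have px : `|g d x0 - x0| <= rho by apply: stay; rewrite // subrr normr0.
  have -> : h d (g d x0) - x0 - d *: (v + w) =
      (h d (g d x0) - h d x0 - (g d x0 - x0)) + (h d x0 - x0 - d *: w) +
      (g d x0 - x0 - d *: v).
    by apply/rowP => i; rewrite !mxE; ring.
  rewrite (le_trans (ler_norm3D _ _ _))//.
  have := g0 d d0 dr; have := h0 d d0 drho.
  have := hd d (g d x0) x0 d0 drho px; rewrite subrr normr0 => /(_ (ltW rho0)).
  have : Kh * d * `|g d x0 - x0| <= Kh * d * (Kg * r).
    rewrite ler_pM2l ?mulr_gt0// (le_trans (gd0 d d0 dr))//.
    by rewrite ler_pM2l.
  have : d * (r * (4 * Kh * Kg)) <= d * e by rewrite ler_pM2l.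
  have : 0 < e * d by rewrite mulr_gt0.
    by lra.
(* This gives [|a - b| <= |b|], so [|a| <= 2 |b|]; the error of [h] then costs half of [e], and the
   two other terms a quarter each. *)
have rK1 : r <= 1 / Kg by near: r; apply: nbhs_right_le; rewrite divr_gt0.
have : r <= e / (4 * (row_sum_norm B + 1) * Kg).
  near: r; apply: nbhs_right_le.
  by rewrite divr_gt0// mulr_gt0// mulr_gt0// ltr_wpDl.
rewrite ler_pdivlMr; last by rewrite mulr_gt0// mulr_gt0// ltr_wpDl.
move: rK1; rewrite ler_pdivlMr// => rK1 rK.
set a := g d x - g d y; set b := x - y.
have -> : h d (g d x) - h d (g d y) - b - d *: (b *m (A + B)) =
    (h d (g d x) - h d (g d y) - a - d *: (a *m B)) +
    (a - b - d *: (b *m A)) + d *: ((a - b) *m B).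
  rewrite mulmxDr (mulmxBl a b).
  move: (h d _) (h d (g d y)) (b *m A) (b *m B) (a *m B).
  by move=> *; apply/rowP => i; rewrite !mxE; ring.
rewrite (le_trans (ler_norm3D _ _ _))//.
have H1 := hL d _ _ d0 (le_trans dr rrho) (stay d x d0 dr xr)
  (stay d y d0 dr yr).
have H2 := gL d x y d0 dr xr yr.
have H3 := gd d x y d0 dr xr yr.
have aE : `|a| <= `|a - b| + `|b| by rewrite -{1}(subrK b a) ler_normD.
have H4 : `|(a - b) *m B| <= row_sum_norm B * `|a - b|.
  exact: norm_mulmx_le.
rewrite normrZ gtr0_norm//.
rewrite -/a -/b in H1 H2 H3.
have b0 : 0 <= `|b| by [].
have dKg : d * Kg <= 1 by nra.
have H5 : `|a - b| <= `|b| by nra.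
have H6 : e / 4 * d * `|a| <= e / 4 * d * (2 * `|b|).
  by rewrite ler_pM2l ?mulr_gt0//; lra.
have H7 : d * `|(a - b) *m B| <= d * (row_sum_norm B * (Kg * d * `|b|)).
  rewrite ler_pM2l// (le_trans H4)// ler_wpM2l//.
have H8 : d * (row_sum_norm B * (Kg * d * `|b|)) <= e / 4 * d * `|b|.
  have -> : d * (row_sum_norm B * (Kg * d * `|b|)) =
    (row_sum_norm B * (Kg * d)) * (d * `|b|) by ring.
  rewrite -[leRHS]mulrA ler_wpM2r ?mulr_ge0 ?(ltW d0)//.
  have : Kg * d <= Kg * r by rewrite ler_pM2l.
  have : 0 < Kg * d by rewrite mulr_gt0.
  by nra.
lra.
Unshelve. all: by end_near. Qed.

End expansion.

(** * Expansion of a flow *)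

Section flow.
Context {R : realType} {n : nat}.
Implicit Types (V : 'rV[R]_n -> 'rV[R]_n) (F : 'rV[R]_n -> R -> 'rV[R]_n).

(** For short times trajectories stay where [V] is nearly affine, so a trajectory, or a difference
    of two, minus its predicted linear motion has a small derivative; the mean value inequality
    integrates this bound. *)
Lemma flow_expands V F x0 A : strictly_differentiable_at V x0 A ->
  is_flow V F -> expands (fun d x => F x d) x0 (V x0) A.
Proof.
move=> VA [F0 FV] e e0.
pose C := row_sum_norm A; have C0 : 0 <= C := row_sum_norm_ge0 A.
have e4 : 0 < e / 4 by rewrite divr_gt0.
(* A Lipschitz constant of [V] on the [rho]-ball; [M] below bounds the speed there. *)
pose L := C + e / 4; have L0 : 0 < L by rewrite ltr_wpDl.
near (0 : R)^'+ => rho.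
have rho0 : 0 < rho by [].
have Vrho (x y : 'rV[R]_n) : `|x - x0| < rho -> `|y - x0| < rho ->
    `|V x - V y - (x - y) *m A| <= e / 4 * `|x - y|.
  by move: x y; near: rho; exact: VA.
have VL (x y : 'rV[R]_n) : `|x - x0| < rho -> `|y - x0| < rho ->
    `|V x - V y| <= L * `|x - y|.
  move=> xr yr; rewrite -(subrK ((x - y) *m A) (V x - V y)).
  rewrite (le_trans (ler_normD _ _))//.
  have := Vrho x y xr yr; have := norm_mulmx_le (x - y) A.
  rewrite -/C /L; lra.
have x0rho : `|x0 - x0| < rho by rewrite subrr normr0.
pose M := `|V x0| + L * rho.
have M0 : 0 < M by rewrite ltr_wpDl// mulr_gt0.
have VM (x : 'rV[R]_n) : `|x - x0| < rho -> `|V x| <= M.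
  move=> xr; rewrite -(subrK (V x0) (V x)) (le_trans (ler_normD _ _))//.
  rewrite addrC lerD2l (le_trans (VL _ _ xr x0rho))//.
  by rewrite ler_pM2l// ltW.
near=> r.
have r0 : 0 < r by [].
(* Initial distance [r] plus travel [M * r] stays below [rho]. *)
have rM : r < rho / (1 + M).
  by near: r; apply: nbhs_right_lt; rewrite divr_gt0// (addr_gt0 ltr01 M0).
rewrite (ltr_pdivlMr _ _ (addr_gt0 ltr01 M0)) in rM.
have stay (x : 'rV[R]_n) (t : R) : `|x - x0| <= r -> 0 <= t -> t <= r ->
    `|F x t - x0| < rho /\ `|F x t - x| <= M * t.
  move=> xr t0 tr; rewrite -{3}(F0 x).
  apply: (mean_value_confined (FV x) _ _ (ltW M0) t0 tr).
    by move=> s _ _; exact: VM.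
  by rewrite F0; nra.
(* Three bounds on [r]: [rL] serves the estimate at [x0], [rC] the term with [A] in the two-point
   estimate, and [rL1] the confinement of [F x - F y]. *)
have rL : r <= e / (4 * L * M).
  by near: r; apply: nbhs_right_le; rewrite divr_gt0// !mulr_gt0.
rewrite ler_pdivlMr ?mulr_gt0// in rL.
have rC : r <= e / (4 * L * (C + 1)).
  near: r; apply: nbhs_right_le.
  by rewrite divr_gt0// ?mulr_gt0// ltr_wpDl.
rewrite ler_pdivlMr ?mulr_gt0// ?ltr_wpDl// in rC.
have rL1 : r < 1 / (2 * L).
  by near: r; apply: nbhs_right_lt; rewrite divr_gt0// mulr_gt0.
rewrite ltr_pdivlMr ?mulr_gt0// in rL1.
split=> [d d0 dr|d x y d0 dr xr yr].
  have := @mean_value_le R n (fun t => F x0 t - t *: V x0)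
    (fun t => V (F x0 t) - V x0) e d (ltW d0).
  rewrite F0 scale0r subr0 addrAC; apply.
    by move=> s; apply: is_deriveB; [exact: FV | exact: is_derive_scaler].
  move=> s s0 sd; have sr : s <= r by rewrite (le_trans _ dr)// ltW.
  have x0r : `|x0 - x0| <= r by rewrite subrr normr0 ltW.
  have [Fr Fs] := stay x0 s x0r s0 sr.
  rewrite (le_trans (VL _ _ Fr x0rho))//.
  have : L * `|F x0 s - x0| <= L * (M * r).
    by rewrite ler_pM2l// (le_trans Fs)// ler_pM2l.
  lra.
(* The confinement below needs a ball of positive radius [|x - y|]. *)
have [->|xy] := eqVneq x y.
  by rewrite !subrr mul0mx scaler0 subr0 normr0 mulr0.
have {}xy : 0 < `|x - y| by rewrite normr_gt0 subr_eq0.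
have DV (s : R) : is_derive s (1 : R) (fun t => F x t - F y t)
    (V (F x s) - V (F y s)) by exact: is_deriveB.
(* [F x - F y] is Lipschitz-driven by its own size, so confining it to the ball
   of radius [|x - y|] around its initial value replaces Gronwall. *)
have near_init (t : R) : 0 <= t -> t <= r ->
    `|F x t - F y t - (x - y)| < `|x - y| /\
    `|F x t - F y t - (x - y)| <= 2 * L * `|x - y| * t.
  move=> t0 tr; rewrite -{5}(F0 x) -{5}(F0 y).
  have L2 : 0 <= 2 * L * `|x - y| by rewrite !mulr_ge0// ltW.
  apply: (mean_value_confined DV _ _ L2 t0 tr).
    move=> s s0 sr Ds.
    have [Fx _] := stay x s xr s0 sr; have [Fy _] := stay y s yr s0 sr.
    rewrite (le_trans (VL _ _ Fx Fy))//.
    rewrite (mulrC 2) -mulrA ler_pM2l//.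
    rewrite -(subrK (x - y) (F x s - F y s)) (le_trans (ler_normD _ _))//.
    lra.
  by rewrite !F0 subrr normr0 add0r; nra.
have := @mean_value_le R n (fun t => F x t - F y t - t *: ((x - y) *m A))
    (fun t => V (F x t) - V (F y t) - (x - y) *m A) (e * `|x - y|) d (ltW d0).
rewrite !F0 scale0r subr0 addrAC mulrAC; apply.
  by move=> s; apply: is_deriveB; [exact: DV | exact: is_derive_scaler].
move=> s s0 sd; have sr : s <= r by rewrite (le_trans _ dr)// ltW.
have [Fx _] := stay x s xr s0 sr; have [Fy _] := stay y s yr s0 sr.
have [D1 D2] := near_init s s0 sr.
have H1 := Vrho _ _ Fx Fy.
set D := F x s - F y s in D1 D2 H1 *.
(* The first term is at most [e / 4 * |D|] with [|D| <= 2 |x - y|], the second is small by [rC];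
   each takes half of [e]. *)
have -> : V (F x s) - V (F y s) - (x - y) *m A =
  (V (F x s) - V (F y s) - D *m A) + (D - (x - y)) *m A.
  by rewrite (mulmxBl D (x - y)) subrKA.
rewrite (le_trans (ler_normD _ _))//.
have H2 := norm_mulmx_le (D - (x - y)) A.
have D3 : `|D| <= 2 * `|x - y|.
  rewrite -(subrK (x - y) D) (le_trans (ler_normD _ _))//; lra.
have H3 : e / 4 * `|D| <= e / 4 * (2 * `|x - y|) by rewrite ler_pM2l.
have H4 : C * `|D - (x - y)| <= C * (2 * L * `|x - y| * r).
  by rewrite ler_wpM2l// (le_trans D2)// ler_pM2l// !mulr_gt0.
have H5 : r * (4 * L * (C + 1)) * `|x - y| <= e * `|x - y|.
  by rewrite ler_pM2r.
have H6 : 0 <= r * L * `|x - y| by rewrite !mulr_ge0// ltW.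
rewrite -/C in H2.
lra.
Unshelve. all: by end_near. Qed.

End flow.

(** * Fixed points from an invertible linear part *)

Section fixed_point.
Context {R : realType} {n : nat}.

(** A simplified Newton iteration for [g d x - x = 0], with the derivative frozen at [d *: A]. *)
Lemma expands_fixed_point (g : R -> 'rV[R]_n -> 'rV[R]_n) x0 A :
  A \in unitmx -> expands g x0 0 A ->
  exists2 r : R, 0 < r & forall d, 0 < d -> d < r -> exists p, g d p = p.
Proof.
move=> Au gE; pose C := row_sum_norm (invmx A).
have C0 : 0 <= C := row_sum_norm_ge0 _.
have C1 : 0 < 2 * (C + 1) by rewrite mulr_gt0// ltr_wpDl.
(* Then [C * e <= 1 / 2], the contraction factor of [T]. *)
have [e e0 eC] : exists2 e, 0 < e & e * (C + 1) = 1 / 2.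
  exists (1 / (2 * (C + 1))); first by rewrite divr_gt0.
  by field; rewrite gt_eqF// ltr_wpDl.
near (0 : R)^'+ => rho.
have rho0 : 0 < rho by [].
have [_ gL] : expansion_error_le g x0 0 A e rho by near: rho; exact: gE.
(* The second precision, [e * rho], makes [T] move the centre by at most [rho / 2]; with factor
   [1 / 2] the [rho]-ball is then mapped into itself. *)
near (0 : R)^'+ => r.
have r0 : 0 < r by [].
have [gx0 _] : expansion_error_le g x0 0 A (e * rho) r.
  by near: r; exact: (gE _ (mulr_gt0 e0 rho0)).
have rrho : r <= rho by near: r; exact: nbhs_right_le.
exists r => // d d0 dr.
have dinv : d^-1 * d = 1 by rewrite mulVf// gt_eqF.
have dV0 : 0 < d^-1 by rewrite invr_gt0.
pose T x := x - d^-1 *: ((g d x - x) *m invmx A).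
pose U := [set x : 'rV[R]_n | `|x - x0| <= rho].
have TL x y : U x -> U y -> `|T x - T y| <= 1 / 2 * `|x - y|.
  move=> Ux Uy.
  (* As [(x - y) *m A *m invmx A = x - y], only the expansion error survives. *)
  have -> : T x - T y = - d^-1 *:
      ((g d x - g d y - (x - y) - d *: ((x - y) *m A)) *m invmx A).
    rewrite /T (mulmxBl _ (d *: _)) -scalemxAl mulmxK//.
    rewrite scalerBr scalerA mulNr dinv.
    rewrite !mulmxBl.
    move: (g d x *m _) (g d y *m _) (x *m _) (y *m _) => ? ? ? ?.
    by apply/rowP => i; rewrite !mxE; ring.
  rewrite normrZ normrN gtr0_norm// ler_pdivrMl//.
  rewrite (le_trans (norm_mulmx_le _ _))// -/C.
  have H := gL d x y d0 (le_trans (ltW dr) rrho) Ux Uy.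
  rewrite (le_trans (ler_wpM2l C0 H))//.
  have dz : 0 <= d * `|x - y| by rewrite mulr_ge0// ltW.
  have : (1 / 2 - C * e) * (d * `|x - y|) >= 0 by rewrite mulr_ge0//; lra.
  lra.
have Ux0 : U x0 by rewrite /U/= subrr normr0 ltW.
have Tx0 : `|T x0 - x0| <= 1 / 2 * rho.
  rewrite /T addrAC subrr add0r normrN normrZ gtr0_norm// ler_pdivrMl//.
  rewrite (le_trans (norm_mulmx_le _ _))// -/C.
  have := gx0 d d0 (ltW dr); rewrite scaler0 subr0 => H.
  rewrite (le_trans (ler_wpM2l C0 H))//.
  have dz : 0 <= d * rho by rewrite mulr_ge0// ltW.
  have : (1 / 2 - C * e) * (d * rho) >= 0 by rewrite mulr_ge0//; lra.
  lra.
have TU : {homo T : x / U x >-> U x}.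
  move=> x Ux; rewrite /U/= -(subrKA (T x0)) (le_trans (ler_normD _ _))//.
  by have := TL _ _ Ux Ux0; move: Ux; rewrite /U/=; lra.
have [|||p _ pT] := @banach_fixed_point R 'rV[R]_n U (mkfun TU).
- exists (1 / 2)%:nng; split; first by rewrite /=; lra.
  by move=> [x y] [/= Ux Uy]; exact: TL.
- have -> : U = closed_ball x0 rho.
    rewrite closed_ballE//; apply/seteqP.
    by split => x; rewrite /U/closed_ball_/= distrC.
  exact: closed_ball_closed.
- by exists x0.
exists p; apply/eqP; rewrite -subr_eq0; apply/eqP.
move: pT; rewrite /= /mkfun /T => /eqP.
rewrite eq_sym subr_eq addrC -subr_eq subrr.
rewrite eq_sym scaler_eq0 invr_eq0 gt_eqF//= => /eqP pT.
by rewrite -(mulmxKV Au (g d p - p)) pT mul0mx.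
Unshelve. all: by end_near. Qed.

End fixed_point.

(** * Composition around the cycle *)

Lemma expands_iteri (R : realType) (n : nat)
    (G : nat -> R -> 'rV[R]_n -> 'rV[R]_n) x0 v (A : nat -> 'M[R]_n) :
  (forall i, expands (G i) x0 (v i) (A i)) ->
  forall N, expands (fun d x => iteri N (fun i => G i d) x) x0
    (\sum_(i < N) v i) (\sum_(i < N) A i).
Proof.
move=> GE; elim=> [|N IH]; first by rewrite !big_ord0; exact: expands_id.
by rewrite !big_ord_recr; exact: expands_comp IH (GE N).
Qed.

Theorem theorem1 (R : realType) (n k : nat) (hn : (0 < n)%N) (hk : (0 < k)%N)
    (V : 'I_k -> 'rV[R]_n -> 'rV[R]_n)
    (F : 'I_k -> 'rV[R]_n -> R -> 'rV[R]_n)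
    (m : 'I_k -> R) (x0 : 'rV[R]_n)
    (V_smooth : forall j, smooth (V j))
    (F_flow : forall j, is_flow (V j) (F j))
    (x0_regular : regular_stasis_point V m x0) :
  exists delta0 : R, 0 < delta0 /\
    forall delta : R, 0 < delta -> delta < delta0 ->
      exists x : 'I_k -> 'rV[R]_n,
        cycle_with_times F x (fun j => delta * m j).
Proof.
have [[[m_gt0 _] V0] J_unit] := x0_regular.
case: k hk V F m V_smooth F_flow m_gt0 V0 J_unit {x0_regular} => // k _ V F m
  V_smooth F_flow m_gt0 V0 J_unit.
(* Indexing by [nat] through [inord] allows iteration; only indices up to [k] are ever reached. *)
pose G (i : nat) d (x : 'rV[R]_n) := F (inord i) x (d * m (inord i)).
have GE i : expands (G i) x0 (m (inord i) *: V (inord i) x0)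
    (m (inord i) *: jacobian (V (inord i)) x0).
  apply: (@expands_scale R n (fun d x => F (inord i) x d)) => //.
  apply: flow_expands (F_flow _).
  exact/class_C1_strictly_differentiable/(V_smooth _ 1).
have := expands_iteri GE k.+1.
(* Stasis cancels the drift vector of the full composition. *)
under eq_bigr do rewrite inord_val; rewrite V0.
under eq_bigr do rewrite inord_val.
move/expands_fixed_point => [|delta0 delta0_gt0 fixed].
  (* Regularity is stated with transposed Jacobians. *)
  rewrite -unitmx_tr linear_sum/=.
  by under eq_bigr do rewrite linearZ.
exists delta0; split=> // d d_gt0 /(fixed d d_gt0)[p pE].
(* The point with index [j] is [p] moved by the first [j] flows. *)
exists (fun j => iteri j (fun i => G i d) p); split=> j.
  by rewrite mulr_gt0.
have -> : F j (iteri j (fun i => G i d) p) (d * m j) =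
    iteri j.+1 (fun i => G i d) p by rewrite /= /G inord_val.
(* Only the last index wraps around, and there [pE] closes the cycle. *)
have [jk|] := ltnP j.+1 k.+1; first by rewrite /= modn_small.
rewrite ltnS leq_eqVlt ltnNge -ltnS ltn_ord orbF => /eqP jk.
have j0 : ordS j = 0 :> nat by rewrite /= -jk modnn.
by rewrite j0 -jk.
Qed.
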